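(* Let $\{U_n\}_{n\ge 0}$ be the integer sequence defined by $U_0=0$, $U_1=1$ and $U_{n+2}=6U_{n+1}-U_n$ for $n\ge 0$ (so $0,1,6,35,204,\ldots$). For $n\ge 1$ let ${\mathcal D}_1(n)$ be the smallest positive integer $m$ such that $U_0,U_1,\ldots,U_{n-1}$ are pairwise incongruent modulo $m$. For $n\ge 1$ let $v_n$ be the smallest power of two with $v_n\ge n$, and let $w_n$ be the smallest integer of the form $2^a5^b$ with $a,b\ge 1$ satisfying $2^a5^b\ge 5n/3$. Then for every $n\ge 1$, $$\mathcal D_1(n)=\min\{v_n,w_n\}.$$ Moreover, letting $$\mathcal M=\left\{m\ge 1:\ \left\{m\frac{\log 5}{\log 2}\right\}\ge 1-\frac{\log(6/5)}{\log 2}\right\},$$ where $\{x\}=x-\lfloor x\rfloor$ denotes the fractional part, we have $$\{\mathcal D_1(2),\mathcal D_1(3),\mathcal D_1(4),\ldots\}=\{2^a5^b:\ a\ge 1,\ b\in\mathcal M\cup\{0\}\}.$$ *)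

(* Defs.v *)
From mathcomp Require Export all_boot all_order all_algebra.
From mathcomp Require Export all_classical all_reals all_analysis.
From mathcomp Require Import ring lra zify.

Set Implicit Arguments.
Unset Strict Implicit.
Unset Printing Implicit Defensive.

Import Order.TTheory GRing.Theory Num.Theory.
Local Open Scope classical_set_scope.
Local Open Scope ring_scope.

Definition least (P : set nat) (exP : exists m, P m) : nat :=
  ex_minn (let: ex_intro m Pm := exP in
           ex_intro (fun m => `[< P m >]) m (asboolT Pm)).

Lemma leastP (P : set nat) (exP : exists m, P m) :
  P (least exP) /\ forall k, P k -> (least exP <= k)%N.
Proof.
rewrite /least; case: ex_minnP => m /asboolP Pm min_m.
by split=> // k Pk; apply/min_m/asboolP.
Qed.

Fixpoint U (n : nat) : int :=
  if n is n1.+1 then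
    if n1 is n2.+1 then 6 * U n1 - U n2 else 1
  else 0.

Lemma U0 : U 0 = 0. Proof. by []. Qed.
Lemma U1 : U 1 = 1. Proof. by []. Qed.
Lemma USS n : U n.+2 = 6 * U n.+1 - U n. Proof. by []. Qed.

Definition discriminates (n : nat) : set nat :=
  [set m | (0 < m)%N /\
    forall i j, (i < n)%N -> (j < n)%N -> i <> j ->
      (U i <> U j %[mod m%:Z])%Z].

Lemma U_ge0_lt n : 0 <= U n /\ U n < U n.+1.
Proof.
elim: n => [//|n [U_ge0 ltU]]; split; first exact: le_trans (ltW ltU).
rewrite USS -subr_gt0.
have -> : 6 * U n.+1 - U n - U n.+1 = (U n.+1 - U n) + U n.+1 *+ 4.
  by rewrite -addrA [X in _ + X]addrC !addrA !mulrSr; ring.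
by rewrite ltr_pwDl ?subr_gt0 // mulrn_wge0 // (le_trans U_ge0) // ltW.
Qed.

Lemma U_homo : {homo U : i j / (i < j)%N >-> i < j}.
Proof.
by apply: homo_ltn => [? ? ?|k]; [exact: lt_trans|case: (U_ge0_lt k)].
Qed.

Lemma discriminates_ex n : exists m, discriminates n m.
Proof.
exists `|U n|.+1; split=> // i j ltin ltjn neq_ij.
have small k : (k < n)%N -> (U k %% `|U n|.+1%:Z)%Z = U k.
  move=> ltkn; have [Uk_ge0 _] := U_ge0_lt k.
  have [Un_ge0 _] := U_ge0_lt n.
  rewrite modz_small // Uk_ge0 /= -addn1 PoszD gez0_abs //.
  by rewrite ltzD1 ltW // U_homo.
rewrite !small // => eqU; case: (ltngtP i j) => // /U_homo.
  by rewrite eqU ltxx.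
by rewrite eqU ltxx.
Qed.

Definition D1 (n : nat) : nat := least (discriminates_ex n).

Definition pow2_ge (n : nat) : set nat :=
  [set m | (exists a, m = 2 ^ a)%N /\ (n <= m)%N].

Lemma pow2_ge_ex n : exists m, pow2_ge n m.
Proof. by exists (2 ^ n)%N; split; [exists n|rewrite ltnW // ltn_expl]. Qed.

Definition v (n : nat) : nat := least (pow2_ge_ex n).

Definition pow25_ge (n : nat) : set nat :=
  [set m | (exists a b, [/\ 1 <= a, 1 <= b & m = 2 ^ a * 5 ^ b])%N /\
           5 * n%:R / 3 <= m%:R :> rat].

Lemma pow25_ge_ex n : exists m, pow25_ge n m.
Proof.
exists (2 ^ n.+1 * 5 ^ 1)%N; split; first by exists n.+1, 1%N.
rewrite ler_pdivrMr ?ltr0n // -!natrM ler_nat expn1 mulnC -mulnA mulnA.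
have := ltn_expl n (isT : 1 < 2)%N; rewrite expnS => ltn2; lia.
Qed.

Definition w (n : nat) : nat := least (pow25_ge_ex n).

Definition frac (R : realType) (x : R) : R := x - (Num.floor x)%:~R.

Definition M (R : realType) : set nat :=
  [set m | (1 <= m)%N /\
    1 - ln (6 / 5) / ln 2 <= frac (m%:R * (ln 5 / ln 2) : R)].

(* Main.v *)
(** Write [alpha = 3 + 2 sqrt 2], so that [alpha^n = X n + 2 (U n) sqrt 2].
If [alpha^e = 1] modulo [m], then [U] has period [e] modulo [m]; if
[alpha^e = -1], then [U i = U j] whenever [i + j = e].  For an odd prime [p],
applying Frobenius to [1 + sqrt 2], a square root of [alpha] of norm [-1], gives
[alpha^((p-1)/2) = 1] or [alpha^((p+1)/2) = -1], and both relations lift to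
[p^b] with exponents multiplied by [p^(b-1)].  Combining them over the prime
factors of [m] produces a collision among the first [n] terms as soon as
[m < 2 n], except when [m = 3], [m = 2^a], or [m = 2^a p^b] with
[alpha^((p+1)/2) = -1] and [(p+1)/2] odd.  In the last case [m] discriminates
at most [m (p+1) / (2 p)] terms; this is [3 m / 5] for [p = 5], while for
[p >= 13] a power of two or some [2^c 5^d], with [d] one of [6], [9], [12], fits
between the number of terms and [m].

Conversely, [U (j + 2 k) - U j = 2 (U k) (X (j + k))], where [X] is odd and prime
to [5], so the 2-adic and 5-adic valuations of [U k] decide when [2^a] and
[2^a 5^b] discriminate. *)

Require Import Defs.
From mathcomp Require Import all_boot all_order all_algebra all_field.
From mathcomp Require Import all_classical all_reals all_analysis.
From mathcomp Require Import ring lra zify.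

Set Implicit Arguments.
Unset Strict Implicit.
Unset Printing Implicit Defensive.

Import Order.TTheory GRing.Theory Num.Theory.
Local Open Scope classical_set_scope.
Local Open Scope ring_scope.

(** * Powers of [alpha] and addition formulas *)

(** The companion sequence 1, 3, 17, 99, ..., half the trace of [alpha^n]; deriving it from [U]
    avoids a second recursion. *)
Definition X (n : nat) : int := U n.+1 - 3 * U n.

Lemma U_succ n : U n.+1 = X n + 3 * U n.
Proof. by rewrite /X; ring. Qed.

Lemma X_succ n : X n.+1 = 3 * X n + 8 * U n.
Proof. by rewrite /X USS; ring. Qed.

(** Both parts of the product of [alpha^i] and [alpha^j]; they are proved together because each
    induction step uses both. *)
Lemma UX_add i j :
  U (i + j) = U i * X j + X i * U j /\ X (i + j) = X i * X j + 8 * U i * U j.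
Proof.
elim: i => [|i [IHU IHX]].
  by rewrite add0n U0 /X U1 U0; split; ring.
by rewrite addSn !U_succ !X_succ IHU IHX; split; ring.
Qed.

Lemma U_add i j : U (i + j) = U i * X j + X i * U j.
Proof. by case: (UX_add i j). Qed.

Lemma X_add i j : X (i + j) = X i * X j + 8 * U i * U j.
Proof. by case: (UX_add i j). Qed.

(** [alpha] has norm 1, hence so does each of its powers. *)
Lemma pell n : X n ^+ 2 = 1 + 8 * U n ^+ 2.
Proof.
elim: n => [|n IHn]; first by rewrite /X U1 U0.
suff: X n.+1 ^+ 2 - (1 + 8 * U n.+1 ^+ 2) = X n ^+ 2 - (1 + 8 * U n ^+ 2).
  by rewrite IHn subrr => /eqP; rewrite subr_eq0 => /eqP.
by rewrite U_succ X_succ; ring.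
Qed.

Lemma U_double n : U n.*2 = 2 * (U n * X n).
Proof. by rewrite -addnn U_add; ring. Qed.

Lemma X_double n : X n.*2 = 1 + 16 * U n ^+ 2.
Proof. by rewrite -addnn X_add -expr2 pell; ring. Qed.

(** Serves the 5-adic valuation: when 5 divides [U n], the second factor is 5 times a number
    congruent to 1 modulo 5. *)
Lemma U_quintuple n : U (5 * n) = U n * (1024 * U n ^+ 4 + 160 * U n ^+ 2 + 5).
Proof.
have -> : (5 * n = n.*2.*2 + n)%N by lia.
have U4 : U n ^+ 4 = (U n ^+ 2) ^+ 2 by rewrite -exprM.
rewrite U_add !(U_double, X_double) U4.
have p := pell n.
have -> : 2 * (2 * (U n * X n) * (1 + 16 * U n ^+ 2)) * X n =
          4 * U n * (1 + 16 * U n ^+ 2) * X n ^+ 2 by ring.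
have -> : (1 + 16 * (2 * (U n * X n)) ^+ 2) * U n =
          (1 + 64 * U n ^+ 2 * X n ^+ 2) * U n by ring.
by rewrite p; ring.
Qed.

Lemma U_sub_even j k : U (j + k.*2) - U j = 2 * (U k * X (j + k)).
Proof.
have -> : (j + k.*2 = j + k + k)%N by lia.
(* This multiplies [alpha^(j + k)] by [alpha^(-k)], the conjugate of [alpha^k]. *)
have -> : U j = U (j + k) * X k - X (j + k) * U k.
  rewrite U_add X_add.
  have -> : (U j * X k + X j * U k) * X k - (X j * X k + 8 * U j * U k) * U k
     = U j * X k ^+ 2 - 8 * U j * U k ^+ 2 by ring.
  by rewrite pell; ring.
by rewrite U_add; ring.
Qed.

(** * Relations [alpha^e = s] modulo [m] *)

(* [alpha^e = s] modulo [m], up to the factor [2] of [sqrt 2] when [m] is even. *)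
Definition unit_pow (m : nat) (s : int) (e : nat) : Prop :=
  (m %| U e)%Z /\ (m %| X e - s)%Z.

Lemma unit_pow0 m : unit_pow m 1 0.
Proof. by split; rewrite ?U0 /X ?U1 ?U0 ?subrr dvdz0. Qed.

Lemma unit_powD m s t e f :
  unit_pow m s e -> unit_pow m t f -> unit_pow m (s * t) (e + f).
Proof.
move=> [Ue Xe] [Uf Xf]; split.
  by rewrite U_add rpredD //; [exact: dvdz_mulr|exact: dvdz_mull].
have -> : X (e + f) - s * t =
    (X e - s) * X f + s * (X f - t) + 8 * U e * U f by rewrite X_add; ring.
apply: rpredD; last exact: dvdz_mull.
by apply: rpredD; [exact: dvdz_mulr|exact: dvdz_mull].
Qed.

Lemma unit_powM m s e k : unit_pow m s e -> unit_pow m (s ^+ k) (k * e).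
Proof.
move=> h; elim: k => [|k IHk]; first exact: unit_pow0.
by rewrite exprS mulSn; exact: unit_powD.
Qed.

Lemma unit_pow1M m e k : unit_pow m 1 e -> unit_pow m 1 (k * e).
Proof. by move=> /(unit_powM k); rewrite expr1n. Qed.

Lemma unit_powN1M m e k : odd k -> unit_pow m (-1) e -> unit_pow m (-1) (k * e).
Proof. by move=> odd_k /(unit_powM k); rewrite -signr_odd odd_k. Qed.

Lemma unit_powN1_double m e : unit_pow m (-1) e -> unit_pow m 1 (2 * e).
Proof. by move=> /(unit_powM 2); rewrite sqrrN expr1n. Qed.

Lemma unit_pow_coprime m1 m2 s e : coprime m1 m2 ->
  unit_pow m1 s e -> unit_pow m2 s e -> unit_pow (m1 * m2) s e.
Proof.
move=> co [U1 X1] [U2 X2].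
by split; rewrite PoszM Gauss_dvdz ?U1 ?X1.
Qed.

(** * Collisions forced by such relations *)

Lemma eqmodzP (m : nat) (x y : int) :
  (x = y %[mod m])%Z <-> (m %| x - y)%Z.
Proof. by rewrite -eqz_mod_dvd; split => [->|/eqP]. Qed.

Lemma U_period m e i : unit_pow m 1 e -> (m %| U (i + e) - U i)%Z.
Proof.
move=> [Ue Xe]; have -> : U (i + e) - U i = U i * (X e - 1) + X i * U e.
  by rewrite U_add; ring.
by rewrite rpredD // dvdz_mull.
Qed.

(** Here [alpha^i] is minus the conjugate of [alpha^j], and these two have the same coefficient of
    [sqrt 2]. *)
Lemma U_reflect m e i j : unit_pow m (-1) e -> (i + j = e)%N ->
  (m %| U i - U j)%Z.
Proof.
move=> [Ue Xe] ije; move: Ue Xe; rewrite -ije opprK => Ue Xe.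
have -> : U i - U j = U (i + j) * X j - (X (i + j) + 1) * U j.
  rewrite U_add X_add.
  have -> : (U i * X j + X i * U j) * X j - (X i * X j + 8 * U i * U j + 1) * U j
     = U i * X j ^+ 2 - 8 * U i * U j ^+ 2 - U j by ring.
  by rewrite pell; ring.
by rewrite rpredB // dvdz_mulr.
Qed.

Lemma collision_bound n m i j :
  discriminates n m -> (j < i)%N -> (m %| U i - U j)%Z -> (n <= i)%N.
Proof.
move=> [_ dis] ltji /eqmodzP eqU; rewrite leqNgt; apply/negP => ltin.
by apply: (dis i j) eqU; lia.
Qed.

Lemma period_bound n m e :
  discriminates n m -> unit_pow m 1 e -> (0 < e)%N -> (n <= e)%N.
Proof.
by move=> dis /(U_period 0) h e_gt0; exact: (collision_bound dis e_gt0).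
Qed.

Lemma reflection_bound n m e :
  discriminates n m -> unit_pow m (-1) e -> (0 < e)%N -> (n <= e./2.+1)%N.
Proof.
(* The most central pair of distinct indices with sum [e]; for even [e] the exact middle would pair
   an index with itself. *)
move=> dis h e_gt0; apply: (@collision_bound n m _ (e - e./2.+1)) => //.
  by lia.
by apply: (U_reflect h); lia.
Qed.

(* Solve [i - j = P] and [i + j = t * E] with [t] odd, as small as possible. *)
Lemma mixed_bound n m1 m2 P E : coprime m1 m2 ->
  discriminates n (m1 * m2) -> unit_pow m1 1 P -> unit_pow m2 (-1) E ->
  odd P = odd E -> (0 < P)%N -> (0 < E)%N -> (n < P + E)%N.
Proof.
move=> co dis h1 h2 odd_PE P_gt0 E_gt0.
(* With this [d], [S] is the least odd multiple of [E] with [P <= S]. Hence [S < P + 2 E], and the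
   larger index [(S + P) / 2] stays below [P + E]. *)
pose d := ((P + E).-1 %/ (2 * E))%N.
have dE := divn_eq (P + E).-1 (2 * E).
have ltd : ((P + E).-1 %% (2 * E) < 2 * E)%N by rewrite ltn_pmod ?muln_gt0.
rewrite -/d in dE; set r := (_ %% _)%N in dE ltd.
pose S := ((2 * d + 1) * E)%N.
have SE : S = (d * (2 * E) + E)%N by rewrite /S; ring.
have oddS : odd S = odd P by rewrite SE odd_PE; lia.
have h2S : unit_pow m2 (-1) S by apply: unit_powN1M => //; lia.
pose j := ((S - P)./2)%N.
have jP : (j.*2 + P = S)%N by rewrite /j; lia.
apply: (@leq_ltn_trans (j + P)); last by lia.
apply: (collision_bound dis (j := j)); first by lia.
rewrite PoszM Gauss_dvdz // (U_period _ h1) /=.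
by apply: (U_reflect h2S); lia.
Qed.

(** * Frobenius and odd primes *)

(** A splitting field of [X^2 - 2] over ['F_p] serves whether or not 2 is a square modulo [p]. *)
Lemma sqrt2_in_char p : prime p ->
  exists (L : fieldType) (s : L), s ^+ 2 = 2 /\ p \in [pchar L].
Proof.
move=> p_pr; pose q : {poly 'F_p} := 'X^2 - 2%:P.
have sq : size q = 3.
  by rewrite size_polyDl ?size_polyXn // size_polyN size_polyC; case: eqP.
have q_neq0 : q != 0 by rewrite -size_poly_eq0 sq.
have [L [rs qrs _]] := FinSplittingFieldFor q_neq0.
have : size (\prod_(z <- rs) ('X - z%:P)) = 3.
  by rewrite -(eqp_size qrs) size_map_poly sq.
case: rs qrs => [|s rs] qrs; first by rewrite big_nil size_poly1.
exists L, s; split; last by rewrite pchar_lalg pchar_Fp.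
have : root (\prod_(z <- s :: rs) ('X - z%:P)) s.
  by rewrite root_prod_XsubC mem_head.
rewrite -(eqp_root qrs) rmorphB /= map_polyXn map_polyC /= rootE !hornerE.
by rewrite subr_eq0 scaler_nat => /eqP.
Qed.

Lemma alpha_pow (L : comNzRingType) (s : L) n : s ^+ 2 = 2 ->
  (3 + 2 * s) ^+ n = (X n)%:~R + 2 * (U n)%:~R * s.
Proof.
move=> s2; elim: n => [|n IHn].
  by rewrite expr0 /X U1 U0 !rmorph0 mulr0 subr0 mulr0 mul0r addr0.
rewrite exprSr IHn X_succ U_succ; move: (X n) (U n) => x u.
rewrite !(intrD, intrM) /=.
have -> : (x%:~R + 2 * u%:~R * s) * (3 + 2 * s) =
  3 * x%:~R + (2 * x%:~R + 6 * u%:~R) * s + 4 * u%:~R * s ^+ 2 :> L by ring.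
by rewrite s2; ring.
Qed.

(** Since [s] may lie in the prime field, coefficients cannot be compared directly. But the norm is
    1 and [t] is its own inverse, so the conjugate power equals [t] too; sum and difference then
    isolate [X e] and [U e]. *)
Lemma unit_pow_field (L : fieldType) (s : L) (p : nat) (t : int) e :
  odd p -> p \in [pchar L] -> s ^+ 2 = 2 -> t ^+ 2 = 1 ->
  (3 + 2 * s) ^+ e = t%:~R -> unit_pow p t e.
Proof.
move=> odd_p pL s2 t2; rewrite alpha_pow // => eq_t.
have two_neq0 : 2 != 0 :> L.
  have := pcharf_prime pL => p_pr; rewrite -(dvdn_pcharf pL) dvdn_prime2 //.
  by apply: contraL odd_p => /eqP ->.
have s_neq0 : s != 0 by rewrite -sqrf_eq0 s2.
have tL : t%:~R ^+ 2 = 1 :> L by rewrite -rmorphXn /= t2.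
have XL : (X e)%:~R ^+ 2 = 1 + 8 * (U e)%:~R ^+ 2 :> L.
  by rewrite -rmorphXn /= pell rmorphD rmorphM rmorphXn.
have eqN : (X e)%:~R - 2 * (U e)%:~R * s = t%:~R :> L.
  have norm1 : ((X e)%:~R + 2 * (U e)%:~R * s) *
               ((X e)%:~R - 2 * (U e)%:~R * s) = 1 :> L.
    have -> : ((X e)%:~R + 2 * (U e)%:~R * s) * ((X e)%:~R - 2 * (U e)%:~R * s)
      = (X e)%:~R ^+ 2 - 4 * (U e)%:~R ^+ 2 * s ^+ 2 :> L by ring.
    by rewrite s2 XL; ring.
  have t_neq0 : t%:~R != 0 :> L by rewrite -sqrf_eq0 tL oner_eq0.
  by rewrite eq_t in norm1; apply: (mulfI t_neq0); rewrite norm1 -expr2 tL.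
split; rewrite (dvdz_pcharf pL).
  have : 2 * 2 * (U e)%:~R * s = 0.
    have -> : 2 * 2 * (U e)%:~R * s = ((X e)%:~R + 2 * (U e)%:~R * s) -
      ((X e)%:~R - 2 * (U e)%:~R * s) :> L by ring.
    by rewrite eq_t eqN subrr.
  by move/eqP; rewrite !mulf_eq0 (negPf two_neq0) (negPf s_neq0) orbF.
rewrite rmorphB /= subr_eq0; apply/eqP/(mulfI two_neq0).
have -> : 2 * (X e)%:~R = ((X e)%:~R + 2 * (U e)%:~R * s) +
  ((X e)%:~R - 2 * (U e)%:~R * s) :> L by ring.
by rewrite eq_t eqN; ring.
Qed.

(* Frobenius maps [1 + sqrt 2], whose square is [3 + 2 sqrt 2], to itself or
   to its conjugate; its norm is [-1]. *)
Lemma unit_pow_prime p : prime p -> odd p ->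
  unit_pow p 1 p./2 \/ unit_pow p (-1) p./2.+1.
Proof.
move=> p_pr odd_p; have [L [s [s2 pL]]] := sqrt2_in_char p_pr.
have eps2 : (1 + s) ^+ 2 = 3 + 2 * s.
  by rewrite sqrrD expr1n s2 mul1r; ring.
have frob : (1 + s) ^+ p = 1 + s ^+ p.
  rewrite -!(pFrobenius_autE pL) pFrobenius_autD_comm ?pFrobenius_aut1 //.
  exact: mulrC.
have : s ^+ p = s \/ s ^+ p = - s.
  have : (s ^+ p) ^+ 2 == s ^+ 2.
    by rewrite -exprM mulnC exprM s2 -(pFrobenius_autE pL) pFrobenius_aut_nat.
  by rewrite eqf_sqr => /orP[] /eqP ->; [left|right].
have eps_neq0 : 1 + s != 0.
  apply/negP => /eqP/(congr1 ( *%R^~ (1 - s))); rewrite mul0r.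
  have -> : (1 + s) * (1 - s) = 1 - s ^+ 2 by ring.
  rewrite s2 => /eqP; have -> : 1 - 2 = -1 :> L by ring.
  by rewrite oppr_eq0 oner_eq0.
have p_half : p = (p./2).*2.+1 by rewrite -[LHS]odd_double_half odd_p.
case=> sp; rewrite sp in frob; [left|right];
  apply: (unit_pow_field odd_p pL s2) => //; rewrite -eps2 -exprM mul2n.
  (* If Frobenius fixes [1 + s], cancelling one factor gives [(1 + s)^(p - 1) = 1]; otherwise
     [(1 + s)^(p + 1)] is the norm [-1]. *)
  apply/(mulfI eps_neq0); rewrite -exprS -p_half frob.
  by rewrite mulr1.
rewrite doubleS exprS -p_half frob rmorphN1.
have -> : (1 + s) * (1 - s) = 1 - s ^+ 2 by ring.
by rewrite s2; ring.
Qed.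

(** * Lifting to prime powers *)

(* First-order expansion of [(s + d)^k], where [d] is small. *)
Lemma unit_pow_expand (q N : nat) (s : int) e k : s = 1 \/ s = -1 ->
  (N %| q * q)%N -> unit_pow q s e ->
  (N %| U (k * e) - k%:Z * (s ^+ k * s * U e))%Z /\
  (N %| X (k * e) - s ^+ k - k%:Z * (s ^+ k * s * (X e - s)))%Z.
Proof.
move=> s_pm1 dvdN [Ue Xe].
set u := U e in Ue *; set d := X e - s in Xe *.
have dvd2 (x y : int) : (q %| x)%Z -> (q %| y)%Z -> (N %| x * y)%Z.
  move=> hx hy; apply: (@dvdz_trans (q%:Z * q%:Z)); first by rewrite -PoszM dvdzE.
  exact: dvdz_mul.
have uu := dvd2 _ _ Ue Ue; have ud := dvd2 _ _ Ue Xe; have dd := dvd2 _ _ Xe Xe.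
have XeE : X e = s + d by rewrite /d; ring.
elim: k => [|k [IHU IHX]].
  by rewrite mul0n expr0 /X U1 U0 !mul0r mulr0 !subr0 dvdz0.
rewrite mulSn U_add X_add -/u XeE exprS.
have kS : k.+1%:Z = k%:Z + 1 by rewrite -addn1 PoszD.
rewrite kS; set P := s ^+ k in IHU IHX *; set x := X (k * e) in IHX *.
set y := U (k * e) in IHU *; move: (k%:Z) IHU IHX => z IHU IHX.
have s2 : s * s = 1 by case: s_pm1 => ->.
split.
  have -> : u * x + (s + d) * y - (z + 1) * (s * P * s * u) =
    u * (x - P - z * (P * s * d)) + (s + d) * (y - z * (P * s * u)) +
    (2 * z * P * s) * (u * d) + P * u * (1 - s * s) by ring.
  rewrite s2 subrr !mulr0 !addr0.
  by rewrite !rpredD //; exact: dvdz_mull.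
have -> : (s + d) * x + 8 * u * y - s * P - (z + 1) * (s * P * s * d) =
    (s + d) * (x - P - z * (P * s * d)) + 8 * u * (y - z * (P * s * u)) +
    (z * P * s) * (d * d) + (8 * z * P * s) * (u * u) + P * d * (1 - s * s)
    by ring.
rewrite s2 subrr !mulr0 !addr0.
by rewrite !rpredD //; exact: dvdz_mull.
Qed.

(** In the first-order expansion of the [p]-th power the linear term gains a factor [p], while
    [s^p = s] because [p] is odd. *)
Lemma unit_pow_lift p b (s : int) e : s = 1 \/ s = -1 -> odd p ->
  unit_pow (p ^ b.+1) s e -> unit_pow (p ^ b.+2) s (p * e).
Proof.
move=> s_pm1 odd_p h; have [Ue Xe] := h.
set N := (p ^ b.+2)%N.
have dvdp (x : int) : ((p ^ b.+1)%N %| x)%Z -> (N %| p%:Z * x)%Z.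
  by move=> hx; rewrite /N expnS PoszM; exact: dvdz_mul.
have dvdN : (N %| p ^ b.+1 * p ^ b.+1)%N.
  by rewrite -expnD dvdn_exp2l // addnS !addSn ltnS leq_addr.
have [kU kX] := unit_pow_expand p s_pm1 dvdN h.
have sp : s ^+ p = s.
  by case: s_pm1 => ->; rewrite ?expr1n // -signr_odd odd_p.
split.
  have -> : U (p * e) = (U (p * e) - p%:Z * (s ^+ p * s * U e))
     + p%:Z * (s ^+ p * s * U e) by ring.
  by rewrite rpredD // dvdp // dvdz_mull.
have -> : X (p * e) - s = (X (p * e) - s ^+ p - p%:Z * (s ^+ p * s * (X e - s)))
     + p%:Z * (s ^+ p * s * (X e - s)) by rewrite sp; ring.
by rewrite rpredD // dvdp // dvdz_mull.
Qed.

Lemma unit_pow_prime_power p (s : int) e b : s = 1 \/ s = -1 -> odd p ->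
  unit_pow p s e -> unit_pow (p ^ b.+1) s (p ^ b * e).
Proof.
move=> s_pm1 odd_p h; elim: b => [|b IHb]; first by rewrite mul1n.
by rewrite [(p ^ b.+1)%N]expnS -mulnA; exact: unit_pow_lift.
Qed.

Lemma unit_pow_pow2 a : unit_pow (2 ^ a) 1 (2 ^ a).
Proof.
elim: a => [|a [Ua Xa]]; first by split; exact: dvd1z.
rewrite expnS mul2n; split.
  rewrite U_double -mul2n PoszM; apply: dvdz_mul => //; exact: dvdz_mulr.
have -> : X (2 ^ a).*2 - 1 = (2 * U (2 ^ a)) * (8 * U (2 ^ a)).
  by rewrite X_double; ring.
by apply: dvdz_mulr; rewrite -mul2n PoszM; exact: dvdz_mul.
Qed.

Lemma unit_pow_prime_power_cases p b : prime p -> odd p ->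
  unit_pow (p ^ b.+1) 1 (p ^ b * p./2) \/
  unit_pow (p ^ b.+1) (-1) (p ^ b * p./2.+1).
Proof.
move=> p_pr odd_p; case: (unit_pow_prime p_pr odd_p) => h.
  by left; apply: unit_pow_prime_power => //; left.
by right; apply: unit_pow_prime_power => //; right.
Qed.

(** A uniform weakening of both cases: writing the period as [2 e] lets several primes share one
    factor 2. *)
Lemma prime_power_half_period p b : prime p -> odd p ->
  exists e, [/\ (0 < e)%N, unit_pow (p ^ b.+1) 1 (2 * e) &
                (2 * p * e <= p.+1 * p ^ b.+1)%N].
Proof.
move=> p_pr odd_p; have p_gt2 := odd_prime_gt2 odd_p p_pr.
have h_gt0 : (0 < p ^ b)%N by rewrite expn_gt0 prime_gt0.
have p_half : p = (p./2).*2.+1 by rewrite -[LHS]odd_double_half odd_p.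
case: (unit_pow_prime_power_cases b p_pr odd_p) => h.
  exists (p ^ b * p./2)%N; split; [by rewrite muln_gt0 h_gt0; lia|exact: unit_pow1M|].
  rewrite expnS; set g := (p ^ b)%N in h_gt0 *.
  have hp : (2 * p./2 <= p.+1)%N by lia.
  by have := leq_mul (leqnn (p * g)) hp; lia.
exists (p ^ b * p./2.+1)%N; split; [by rewrite muln_gt0 h_gt0|exact: unit_powN1_double|].
rewrite expnS; set g := (p ^ b)%N in h_gt0 *.
have hp : (2 * p./2.+1 <= p.+1)%N by lia.
by have := leq_mul (leqnn (p * g)) hp; lia.
Qed.

(** * Odd moduli *)

(** The common factor 2 is counted once, which is what brings products of periods down to
    [m / 2]. *)
Lemma half_period_coprime m1 m2 e1 e2 : coprime m1 m2 ->
  unit_pow m1 1 (2 * e1) -> unit_pow m2 1 (2 * e2) ->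
  unit_pow (m1 * m2) 1 (2 * (e1 * e2)).
Proof.
move=> co h1 h2; apply: unit_pow_coprime => //.
  have -> : (2 * (e1 * e2) = e2 * (2 * e1))%N by ring.
  exact: unit_pow1M.
have -> : (2 * (e1 * e2) = e1 * (2 * e2))%N by ring.
exact: unit_pow1M.
Qed.

Lemma odd_split m : odd m -> (1 < m)%N ->
  exists p b m', [/\ prime p, odd p, odd m', coprime p m' & m = (p ^ b.+1 * m')%N].
Proof.
move=> odd_m m_gt1; have p_pr := pdiv_prime m_gt1; set p := pdiv m in p_pr.
have m_gt0 : (0 < m)%N by lia.
have [m' co mE] := pfactor_coprime p_pr m_gt0.
have : (0 < logn p m)%N by rewrite logn_gt0 mem_primes p_pr m_gt0 pdiv_dvd.
case: (logn p m) mE => // b mE _; exists p, b, m'.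
move: odd_m; rewrite mE oddM oddX /= => /andP[-> ->].
by split; rewrite // mulnC.
Qed.

Lemma odd_half_period m : odd m ->
  exists e, [/\ (0 < e)%N, unit_pow m 1 (2 * e) & (e <= m)%N].
Proof.
elim/ltn_ind: m => m IHm odd_m.
have [m_gt1|m_le1] := ltnP 1 m; last first.
  have -> : m = 1%N by lia.
  by exists 1%N; split=> //; split; exact: dvd1z.
have [p [b [m' [p_pr odd_p odd_m' co mE]]]] := odd_split odd_m m_gt1.
have p_gt2 := odd_prime_gt2 odd_p p_pr.
have m'_gt0 : (0 < m')%N by lia.
have [e1 [e1_gt0 h1 le1]] := prime_power_half_period b p_pr odd_p.
have q_gt0 : (0 < p ^ b)%N by rewrite expn_gt0; lia.
have [e2 [e2_gt0 h2 le2]] : exists e, [/\ (0 < e)%N, unit_pow m' 1 (2 * e) & (e <= m')%N].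
  by apply: IHm => //; rewrite mE expnS; nia.
exists (e1 * e2)%N; rewrite mE; split; first by rewrite muln_gt0 e1_gt0.
  by apply: half_period_coprime => //; rewrite coprimeXl.
by apply: leq_mul => //; nia.
Qed.

(** The extreme pair is 3 and 5: [4/3] times [6/5] is [8/5]. *)
Lemma two_primes_ratio p q : odd p -> odd q -> (2 < p)%N -> (2 < q)%N -> p != q ->
  (5 * (p.+1 * q.+1) <= 8 * (p * q))%N.
Proof.
move=> op oq p2 q2 npq; have [p_gt4|p_le4] := ltnP 4 p; first by nia.
have q_gt4 : (4 < q)%N by lia.
by nia.
Qed.

(** At most one of the three is 3, so the ratio is at most [4/3] times [(6/5)^2], that is
    [48/25]. *)
Lemma three_primes_ratio p q r : odd p -> odd q -> odd r ->
  (2 < p)%N -> (2 < q)%N -> (2 < r)%N -> p != q -> p != r -> q != r ->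
  (p.+1 * q.+1 * r.+1 <= 2 * (p * q * r))%N.
Proof.
move=> op oq or p2 q2 r2 npq npr nqr.
have h1 := two_primes_ratio op oq p2 q2 npq.
have [r_gt4|r_le4] := ltnP 4 r.
  have h2 : (5 * r.+1 <= 6 * r)%N by lia.
  by have := leq_mul h1 h2; lia.
have rE : r = 3%N by lia.
have h2 : (5 * p.+1 <= 6 * p)%N by lia.
have h3 : (5 * q.+1 <= 6 * q)%N by lia.
by have := leq_mul h2 h3; rewrite rE; lia.
Qed.

Lemma two_primes_half_period p q Q1 Q2 e1 e2 :
  odd p -> odd q -> (2 < p)%N -> (2 < q)%N -> p != q ->
  (2 * p * e1 <= p.+1 * Q1)%N -> (2 * q * e2 <= q.+1 * Q2)%N ->
  (5 * (e1 * e2) <= 2 * (Q1 * Q2))%N.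
Proof.
move=> op oq p2 q2 npq le1 le2; have h := two_primes_ratio op oq p2 q2 npq.
have pq_gt0 : (0 < 4 * (p * q))%N by rewrite !muln_gt0; lia.
rewrite -(leq_pmul2l pq_gt0).
have h1 := leq_mul le1 le2.
have h2 : (5 * (p.+1 * q.+1) * (Q1 * Q2) <= 8 * (p * q) * (Q1 * Q2))%N.
  by rewrite leq_mul2r h orbT.
by lia.
Qed.

Lemma three_primes_half_period p q r Q1 Q2 Q3 e1 e2 e3 :
  odd p -> odd q -> odd r -> (2 < p)%N -> (2 < q)%N -> (2 < r)%N ->
  p != q -> p != r -> q != r ->
  (2 * p * e1 <= p.+1 * Q1)%N -> (2 * q * e2 <= q.+1 * Q2)%N ->
  (2 * r * e3 <= r.+1 * Q3)%N ->
  (4 * (e1 * e2 * e3) <= Q1 * Q2 * Q3)%N.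
Proof.
move=> op oq or p2 q2 r2 npq npr nqr le1 le2 le3.
have h := three_primes_ratio op oq or p2 q2 r2 npq npr nqr.
have pqr_gt0 : (0 < 2 * (p * q * r))%N by rewrite !muln_gt0; lia.
rewrite -(leq_pmul2l pqr_gt0).
have h1 := leq_mul (leq_mul le1 le2) le3.
have h2 : (p.+1 * q.+1 * r.+1 * (Q1 * Q2 * Q3) <= 2 * (p * q * r) * (Q1 * Q2 * Q3))%N.
  by rewrite leq_mul2r h orbT.
by lia.
Qed.

Lemma coprime_prime_powers p q a b : prime p -> prime q -> p != q ->
  coprime (p ^ a) (q ^ b).
Proof.
move=> p_pr q_pr npq; apply/coprimeXl/coprimeXr.
by rewrite prime_coprime // dvdn_prime2.
Qed.

(** Three distinct primes already push the period down to half of their part of [m]; the cofactor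
    [m'] at most multiplies it by [m']. *)
Lemma odd_three_bound n p q r a b c m' :
  let m := (p ^ a.+1 * (q ^ b.+1 * (r ^ c.+1 * m')))%N in
  prime p -> prime q -> prime r -> odd m -> p != q -> p != r -> q != r ->
  coprime p m' -> coprime q m' -> coprime r m' ->
  discriminates n m -> (2 * n <= m)%N.
Proof.
move=> m p_pr q_pr r_pr odd_m npq npr nqr cop coq cor dis.
have [op [oq [or om']]] : odd p /\ odd q /\ odd r /\ odd m'.
  by move: odd_m; rewrite /m !oddM !oddX /= => /andP[-> /andP[-> /andP[-> ->]]].
have p2 := odd_prime_gt2 op p_pr; have q2 := odd_prime_gt2 oq q_pr.
have r2 := odd_prime_gt2 or r_pr.
have [e1 [e1_gt0 h1 le1]] := prime_power_half_period a p_pr op.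
have [e2 [e2_gt0 h2 le2]] := prime_power_half_period b q_pr oq.
have [e3 [e3_gt0 h3 le3]] := prime_power_half_period c r_pr or.
have [e4 [e4_gt0 h4 le4]] := odd_half_period om'.
have le123 := three_primes_half_period op oq or p2 q2 r2 npq npr nqr le1 le2 le3.
have hm : unit_pow m 1 (2 * (e1 * (e2 * (e3 * e4)))).
  do 3! (apply: half_period_coprime => //;
    rewrite ?coprimeMr ?coprime_prime_powers ?coprimeXl //).
have := period_bound dis hm; rewrite !muln_gt0 e1_gt0 e2_gt0 e3_gt0 e4_gt0 => /(_ isT) le_n.
by have := leq_mul le123 le4; rewrite /m; lia.
Qed.

Lemma split_inert_bound n Q1 Q2 P E : coprime Q1 Q2 ->
  discriminates n (Q1 * Q2)%N -> unit_pow Q1 1 P -> unit_pow Q2 (-1) E ->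
  (0 < P)%N -> (0 < E)%N -> (1 < Q2)%N -> (2 * P < Q1)%N -> (3 * E <= 2 * Q2)%N ->
  (2 * n <= Q1 * Q2)%N.
Proof.
move=> co dis hP hE P_gt0 E_gt0 Q2_gt1 ltP leE.
have [odd_P|even_P] := boolP (odd P); last first.
  have hm : unit_pow (Q1 * Q2) 1 (P * E).
    apply: unit_pow_coprime => //; first by rewrite mulnC; exact: unit_pow1M.
    have -> : (P * E = P./2 * (2 * E))%N by lia.
    exact/unit_pow1M/unit_powN1_double.
  have := period_bound dis hm; rewrite muln_gt0 P_gt0 E_gt0 => /(_ isT) le_n.
  have leE2 : (E <= Q2)%N by lia.
  by have := leq_mul (ltnW ltP) leE2; lia.
(* The mixed bound needs equal parities: [P] itself fits an odd [E], and [2 P] an even one. *)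
have le_n : (n < 2 * P + E)%N.
  have [odd_E|even_E] := boolP (odd E).
    apply: leq_trans (mixed_bound co dis hP hE _ _ _) _; rewrite ?odd_P ?odd_E //.
    by lia.
  apply: (mixed_bound co dis (unit_pow1M 2 hP) hE) => //; last by lia.
  by rewrite oddM (negPf even_E).
by nia.
Qed.

(** An even [E] has the parity of [2 F], so the mixed bound applies to [alpha^(2 F) = 1] and
    [alpha^E = -1]. *)
Lemma inert_inert_bound n p q g h : odd p -> odd q -> (2 < p)%N -> (2 < q)%N ->
  p != q -> (0 < g)%N -> (0 < h)%N ->
  let Q1 := (p * g)%N in let Q2 := (q * h)%N in
  let E := (g * p./2.+1)%N in let F := (h * q./2.+1)%N in
  coprime Q1 Q2 -> discriminates n (Q1 * Q2)%N ->
  unit_pow Q1 (-1) E -> unit_pow Q2 (-1) F -> ~~ odd E ->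
  (2 * n <= Q1 * Q2)%N.
Proof.
move=> op oq p2 q2 npq g_gt0 h_gt0 Q1 Q2 E F co dis hE hF even_E.
have EE : (2 * E = Q1 + g)%N.
  by rewrite /E /Q1; have : (2 * p./2.+1 = p.+1)%N; [lia|nia].
have FE : (2 * F = Q2 + h)%N.
  by rewrite /F /Q2; have : (2 * q./2.+1 = q.+1)%N; [lia|nia].
clearbody E F.
have le_n : (n < 2 * F + E)%N.
  rewrite coprime_sym in co; rewrite mulnC in dis.
  apply: (mixed_bound co dis (unit_powN1_double hF) hE); lia.
(* At most one of [p] and [q] is 3; the other is at least 5. *)
have [q_le4|q_gt4] := leqP q 4.
  have hg : (5 * g <= Q1)%N by rewrite /Q1 leq_mul2r; lia.
  have hh : (3 * h <= Q2)%N by rewrite /Q2 leq_mul2r; lia.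
  have : (5 <= Q1)%N by lia.
  have : (3 <= Q2)%N by lia.
  by nia.
have hg : (3 * g <= Q1)%N by rewrite /Q1 leq_mul2r; lia.
have hh : (5 * h <= Q2)%N by rewrite /Q2 leq_mul2r; lia.
have : (3 <= Q1)%N by lia.
have : (5 <= Q2)%N by lia.
by nia.
Qed.

Lemma odd_two_bound n p q a b :
  let m := (p ^ a.+1 * q ^ b.+1)%N in
  prime p -> prime q -> odd m -> p != q ->
  discriminates n m -> (2 * n <= m)%N.
Proof.
move=> m p_pr q_pr odd_m npq dis.
have [op oq] : odd p /\ odd q.
  by move: odd_m; rewrite /m !oddM !oddX /= => /andP[-> ->].
have p2 := odd_prime_gt2 op p_pr; have q2 := odd_prime_gt2 oq q_pr.
have co : coprime (p ^ a.+1) (q ^ b.+1) by exact: coprime_prime_powers.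
have co' : coprime (q ^ b.+1) (p ^ a.+1) by rewrite coprime_sym.
have dis' : discriminates n (q ^ b.+1 * p ^ a.+1)%N by rewrite mulnC.
have g_gt0 : (0 < p ^ a)%N by rewrite expn_gt0; lia.
have h_gt0 : (0 < q ^ b)%N by rewrite expn_gt0; lia.
have := unit_pow_prime_power_cases a p_pr op.
have := unit_pow_prime_power_cases b q_pr oq.
move: co co' dis dis'; rewrite /m !expnS.
set g := (p ^ a)%N in g_gt0 *; set h := (q ^ b)%N in h_gt0 *.
move=> co co' dis dis' [hq|hq] [hp|hp].
- have hm : unit_pow (p * g * (q * h)) 1 (g * p./2 * (h * q./2)).
    apply: unit_pow_coprime => //; last exact: unit_pow1M.
    by rewrite [X in unit_pow _ _ X]mulnC; exact: unit_pow1M.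
  have := period_bound dis hm; rewrite !muln_gt0 g_gt0 h_gt0 => le_n.
  have {}le_n : (n <= g * p./2 * (h * q./2))%N by apply: le_n; lia.
  have le1 : (2 * (g * p./2) <= p * g)%N by nia.
  have le2 : (h * q./2 <= q * h)%N by nia.
  by have := leq_mul le1 le2; lia.
- rewrite [leqRHS]mulnC; apply: (split_inert_bound co' dis' hq hp); rewrite ?muln_gt0; nia.
- apply: (split_inert_bound co dis hp hq); rewrite ?muln_gt0; nia.
have [odd_E|even_E] := boolP (odd (g * p./2.+1)); last first.
  exact: inert_inert_bound co dis hp hq _.
have [odd_F|even_F] := boolP (odd (h * q./2.+1)); last first.
  by rewrite [leqRHS]mulnC; apply: inert_inert_bound co' dis' hq hp _ => //; rewrite eq_sym.
(* Both exponents are odd, so [-1] survives in the product and reflection halves the bound on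
   [n]. *)
have hm : unit_pow (p * g * (q * h)) (-1) (g * p./2.+1 * (h * q./2.+1)).
  apply: unit_pow_coprime => //; last exact: unit_powN1M.
  by rewrite [X in unit_pow _ _ X]mulnC; exact: unit_powN1M.
have := reflection_bound dis hm; rewrite !muln_gt0 g_gt0 h_gt0 => /(_ isT) le_n.
have le1 : (2 * p * (g * p./2.+1) <= p.+1 * (p * g))%N.
  by have : (2 * p./2.+1 = p.+1)%N; [lia|nia].
have le2 : (2 * q * (h * q./2.+1) <= q.+1 * (q * h))%N.
  by have : (2 * q./2.+1 = q.+1)%N; [lia|nia].
have le12 := two_primes_half_period op oq p2 q2 npq le1 le2.
have : (9 <= p * g * (q * h))%N by nia.
by lia.
Qed.

Lemma odd_one_bound n p a :
  let m := (p ^ a.+1)%N in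
  prime p -> odd p -> m != 3%N -> discriminates n m -> (2 * n <= m)%N.
Proof.
move=> m p_pr op; have p2 := odd_prime_gt2 op p_pr.
have g_gt0 : (0 < p ^ a)%N by rewrite expn_gt0; lia.
have := unit_pow_prime_power_cases a p_pr op.
rewrite /m !expnS; set g := (p ^ a)%N in g_gt0 *.
case=> hp ne3 dis.
  have := period_bound dis hp; rewrite muln_gt0 g_gt0 => le_n.
  have {}le_n : (n <= g * p./2)%N by apply: le_n; lia.
  by nia.
have := reflection_bound dis hp; rewrite muln_gt0 g_gt0 => /(_ isT) le_n.
have EE : (2 * (g * p./2.+1) = p * g + g)%N.
  by have : (2 * p./2.+1 = p.+1)%N; [lia|nia].
(* Given [p > 2], this fails only for [p = 3] and [g = 1], which is the excluded modulus 3. *)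
have : (g + 4 <= p * g)%N by nia.
by lia.
Qed.

Lemma odd_bound n m : odd m -> discriminates n m ->
  [\/ m = 1%N, m = 3%N | (2 * n <= m)%N].
Proof.
move=> odd_m dis; have [m_gt1|m_le1] := ltnP 1 m; last by constructor 1; lia.
have [->|m_neq3] := eqVneq m 3%N; first by constructor 2.
constructor 3.
have [p [a [m1 [p_pr op om1 cop mE]]]] := odd_split odd_m m_gt1.
have [m1_gt1|m1_le1] := ltnP 1 m1; last first.
  have m1E : m1 = 1%N by lia.
  by rewrite mE m1E muln1 in m_neq3 dis *; exact: odd_one_bound.
have [q [b [m2 [q_pr oq om2 coq m1E]]]] := odd_split om1 m1_gt1.
have npq : p != q.
  move: cop; rewrite m1E coprimeMr coprime_pexpr // prime_coprime // dvdn_prime2 //.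
  by case/andP.
have [m2_gt1|m2_le1] := ltnP 1 m2; last first.
  have m2E : m2 = 1%N by lia.
  by rewrite mE m1E m2E muln1 in odd_m dis *; exact: odd_two_bound.
have [r [c [m3 [r_pr or om3 cor m2E]]]] := odd_split om2 m2_gt1.
move: cop coq; rewrite mE m1E m2E in odd_m dis *.
rewrite !coprimeMr ![coprime _ (_ ^ _.+1)]coprime_pexpr //.
rewrite ![coprime _ q]prime_coprime // ![coprime _ r]prime_coprime //.
rewrite !dvdn_prime2 // => /andP[_ /andP[npr cop]] /andP[nqr coq].
exact: odd_three_bound.
Qed.

(** * Even moduli *)

(** The primes below 29 with [(p + 1) / 2] odd are 5, 13 and 17; ruling out 17 here spares a
    separate estimate later. *)
Lemma unit_pow_prime_neq17 p : prime p -> odd p ->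
  unit_pow p 1 p./2 \/ p != 17%N /\ unit_pow p (-1) p./2.+1.
Proof.
move=> p_pr op; have [->|ne17] := eqVneq p 17%N.
  (* [alpha^4 = -1] modulo [17] *)
  by left; apply: (unit_powN1_double (e := 4)).
by case: (unit_pow_prime p_pr op); [left|right].
Qed.

(** Let [E] be the exponent with [alpha^E = -1] modulo the odd part. An even [E] shares a factor 2
    with the period of the power of two; an odd [E] does not, and the bound then slightly exceeds
    [m / 2]. *)
Lemma even_prime_power_bound n p a b :
  let m := (2 ^ a.+1 * p ^ b.+1)%N in
  prime p -> odd p -> discriminates n m ->
  (2 * n <= m)%N \/
  [/\ odd p./2.+1, p != 17%N & (2 * n <= 2 ^ a.+1 * (p.+1 * p ^ b))%N].
Proof.
move=> m p_pr op; have p2 := odd_prime_gt2 op p_pr.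
have g_gt0 : (0 < p ^ b)%N by rewrite expn_gt0; lia.
have t_gt0 : (0 < 2 ^ a)%N by rewrite expn_gt0.
have co : coprime (2 ^ a.+1) (p ^ b.+1).
  by rewrite coprime_pexpl // coprime_pexpr // coprime2n.
have h2 := unit_pow_pow2 a.+1.
case: (unit_pow_prime_neq17 p_pr op) => [h|[ne17 h]] dis.
  left; have hp : unit_pow (p ^ b.+1) 1 (p ^ b * p./2).
    by apply: unit_pow_prime_power => //; left.
  have hm : unit_pow m 1 (2 ^ a.+1 * (p ^ b * p./2)).
    apply: unit_pow_coprime => //; last exact: unit_pow1M.
    by rewrite [X in unit_pow _ _ X]mulnC; exact: unit_pow1M.
  have := period_bound dis hm; rewrite !muln_gt0 expn_gt0 g_gt0 => le_n.
  have {}le_n : (n <= 2 ^ a.+1 * (p ^ b * p./2))%N by apply: le_n; lia.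
  apply: leq_trans (_ : 2 * (2 ^ a.+1 * (p ^ b * p./2)) <= _)%N.
    by rewrite leq_mul2l.
  rewrite /m mulnCA leq_mul2l [(p ^ b.+1)%N]expnS; apply/orP; right.
  have hp2 : (2 * p./2 <= p)%N by lia.
  by rewrite mulnCA [(p * _)%N]mulnC leq_mul2l hp2 orbT.
have hp : unit_pow (p ^ b.+1) (-1) (p ^ b * p./2.+1).
  by apply: unit_pow_prime_power => //; right.
have EE : (2 * (p ^ b * p./2.+1) = p.+1 * p ^ b)%N.
  by rewrite mulnCA mulnC; congr (_ * _)%N; lia.
have E_gt0 : (0 < p ^ b * p./2.+1)%N by rewrite muln_gt0 g_gt0.
have [odd_E|even_E] := boolP (odd (p ^ b * p./2.+1)).
  right; split=> //; first by move: odd_E; rewrite oddM => /andP[].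
  have hm : unit_pow m 1 (2 ^ a.+1 * (p ^ b * p./2.+1)).
    apply: unit_pow_coprime => //.
      by rewrite [X in unit_pow _ _ X]mulnC; exact: unit_pow1M.
    rewrite [(2 ^ a.+1)%N]expnS -mulnA mulnCA; exact/unit_pow1M/unit_powN1_double.
  have := period_bound dis hm; rewrite !muln_gt0 expn_gt0 g_gt0 => /(_ isT) le_n.
  by rewrite -EE mulnCA leq_mul2l.
(* Modulo 2 the period 2 and the even [E] allow the mixed bound. For higher powers, the factor 2 of
   [E] supplies the one missing from [2 ^ a.+1]. *)
left; case: a @m t_gt0 co h2 dis => [|a] m t_gt0 co h2 dis.
  have lt_n := mixed_bound co dis h2 hp _ _ _.
  have {}lt_n : (n < 2 ^ 1 + p ^ b * p./2.+1)%N by apply: lt_n => //; lia.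
  rewrite /m [(p ^ b.+1)%N]expnS.
  by have : (3 * p ^ b <= p * p ^ b)%N; [rewrite leq_mul2r; lia|lia].
have hm : unit_pow m 1 (2 ^ a.+1 * (p ^ b * p./2.+1)).
  apply: unit_pow_coprime => //.
    have -> : (2 ^ a.+1 * (p ^ b * p./2.+1) =
              (p ^ b * p./2.+1)./2 * 2 ^ a.+2)%N.
      have {1}-> : (p ^ b * p./2.+1 = 2 * (p ^ b * p./2.+1)./2)%N.
        by move: even_E; set E := (p ^ b * p./2.+1)%N; lia.
      by rewrite [(2 ^ a.+2)%N]expnS; ring.
    exact: unit_pow1M.
  rewrite [(2 ^ a.+1)%N]expnS -mulnA mulnCA; exact/unit_pow1M/unit_powN1_double.
have := period_bound dis hm; rewrite !muln_gt0 expn_gt0 g_gt0 => /(_ isT) le_n.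
apply: leq_trans (_ : 2 * (2 ^ a.+1 * (p ^ b * p./2.+1)) <= _)%N.
  by rewrite leq_mul2l.
rewrite /m mulnCA EE [(2 ^ a.+2)%N]expnS [(2 * _)%N]mulnC -mulnA leq_mul2l.
apply/orP; right; rewrite [(p ^ b.+1)%N]expnS mulnA leq_mul2r.
by lia.
Qed.

Lemma even_bound n m a :
  odd m -> discriminates n (2 ^ a.+1 * m)%N ->
  [\/ m = 1%N, (2 * n <= 2 ^ a.+1 * m)%N |
   exists p b, [/\ prime p, m = (p ^ b.+1)%N, odd p./2.+1, p != 17%N &
                   (2 * n <= 2 ^ a.+1 * (p.+1 * p ^ b))%N]].
Proof.
move=> odd_m dis; have [m_gt1|m_le1] := ltnP 1 m; last by constructor 1; lia.
have [p [b [m1 [p_pr op om1 cop mE]]]] := odd_split odd_m m_gt1.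
have [m1_gt1|m1_le1] := ltnP 1 m1; last first.
  have m1E : m1 = 1%N by lia.
  move: dis; rewrite mE m1E muln1 => dis.
  case: (even_prime_power_bound p_pr op dis) => [|[? ? ?]]; first by constructor 2.
  by constructor 3; exists p, b.
constructor 2.
have [q [c [m2 [q_pr oq om2 coq m1E]]]] := odd_split om1 m1_gt1.
have npq : p != q.
  move: cop; rewrite m1E coprimeMr coprime_pexpr // prime_coprime // dvdn_prime2 //.
  by case/andP.
have cop2 : coprime p m2 by move: cop; rewrite m1E coprimeMr => /andP[].
have p2 := odd_prime_gt2 op p_pr; have q2 := odd_prime_gt2 oq q_pr.
have [e1 [e1_gt0 h1 le1]] := prime_power_half_period b p_pr op.
have [e2 [e2_gt0 h2 le2]] := prime_power_half_period c q_pr oq.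
have [e3 [e3_gt0 h3 le3]] := odd_half_period om2.
have le12 := two_primes_half_period op oq p2 q2 npq le1 le2.
have hm : unit_pow m 1 (2 * (e1 * (e2 * e3))).
  rewrite mE m1E.
  do 2! (apply: half_period_coprime => //;
    rewrite ?coprimeMr ?coprime_prime_powers ?coprimeXl //).
(* The 2 in front of the odd period is absorbed by [2 ^ a.+1], so the ratio [2/5] for two primes
   suffices. *)
have h2m : unit_pow (2 ^ a.+1 * m) 1 (2 ^ a.+1 * (e1 * (e2 * e3))).
  apply: unit_pow_coprime; first by rewrite coprime_pexpl // coprime2n.
    by rewrite mulnC; exact/unit_pow1M/unit_pow_pow2.
  by rewrite expnS -mulnA mulnCA; exact: unit_pow1M.
have := period_bound dis h2m.
rewrite !muln_gt0 expn_gt0 e1_gt0 e2_gt0 e3_gt0 => /(_ isT) le_n.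
apply: leq_trans (_ : 2 * (2 ^ a.+1 * (e1 * (e2 * e3))) <= _)%N.
  by rewrite leq_mul2l.
rewrite mulnCA leq_mul2l mE m1E; apply/orP; right.
by have := leq_mul le12 le3; lia.
Qed.

(** * Fitting [2^k] or [2^a 5^b] between [n] and [m] *)

(** Some candidate for [v n] or [w n] is at most [m]; the condition [5 n / 3 <= 2^a 5^b] is cleared
    of its denominator. *)
Definition sandwiched (n m : nat) : Prop :=
  (exists k, (n <= 2 ^ k <= m)%N) \/
  (exists a b, [/\ (1 <= a)%N, (1 <= b)%N, (5 * n <= 3 * (2 ^ a * 5 ^ b))%N &
                   (2 ^ a * 5 ^ b <= m)%N]).

Lemma pow2_between n : (1 < n)%N -> exists2 k, (n <= 2 ^ k)%N & (2 ^ k < 2 * n)%N.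
Proof.
move=> n_gt1; have /andP[lt_n le_n] := up_log_bounds (isT : 1 < 2)%N n_gt1.
exists (up_log 2 n) => //; case: (up_log 2 n) lt_n le_n => [|k] /= lt_n le_n.
  by lia.
by rewrite expnS ltn_mul2l.
Qed.

Lemma sandwiched_double n m : (0 < n)%N -> (2 * n <= m)%N -> sandwiched n m.
Proof.
move=> n_gt0 le_m; have [n_gt1|n_le1] := ltnP 1 n; last first.
  by left; exists 0%N; lia.
by have [k le_n lt_n] := pow2_between n_gt1; left; exists k; lia.
Qed.

(** For [b = 0] the ends are consecutive integers; for [b = 1] the bound [p^2 < 2^13] leaves a
    finite check; beyond that [29^3 > 2^13]. *)
Lemma no_pow2_small p b k : prime p -> (29 <= p)%N -> (k <= 13)%N ->
  (p ^ b.+1 < 2 ^ k)%N -> (2 ^ k < p.+1 * p ^ b)%N -> False.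
Proof.
move=> p_pr p_ge29 k_le13.
have le13 : (2 ^ k <= 2 ^ 13)%N by rewrite leq_exp2l.
case: b => [|[|b]]; first by rewrite expn0 expn1; lia.
  rewrite expn1 => lt1 lt2.
  have p_lt91 : (p < 91)%N by nia.
  have /allP/(_ p) : all (fun p => all (fun k =>
      ~~ [&& prime p, p ^ 2 < 2 ^ k & 2 ^ k < p.+1 * p]%N) (iota 0 14)) (iota 29 62).
    by vm_compute.
  rewrite mem_iota p_ge29 p_lt91 => /(_ isT)/allP/(_ k).
  by rewrite mem_iota leq0n add0n ltnS k_le13 p_pr lt1 lt2 => /(_ isT).
move=> lt1 _; have : (29 ^ 3 <= p ^ b.+3)%N.
  apply: (@leq_trans (p ^ 3)); first by rewrite leq_exp2r.
  by apply: leq_pexp2l; lia.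
by lia.
Qed.

(** If the power [2^K] in [[n, 2 n)] exceeds [m], trading [2^14] for the slightly smaller [5^6]
    brings it below [m]. When [K < 15], cancelling [2 ^ a.+1] reduces to the finite check. *)
Lemma sandwiched_large n p a b : (0 < n)%N -> prime p -> (29 <= p)%N ->
  (2 * n <= 2 ^ a.+1 * (p.+1 * p ^ b))%N -> sandwiched n (2 ^ a.+1 * p ^ b.+1)%N.
Proof.
move=> n_gt0 p_pr p_ge29 le_n; set m := (_ * _)%N.
have [n_gt1|n_le1] := ltnP 1 n; last first.
  by left; exists 0%N; rewrite /m muln_gt0 !expn_gt0 prime_gt0 //; lia.
have [K le_nK lt_Kn] := pow2_between n_gt1.
have [le_Km|lt_mK] := leqP (2 ^ K) m; first by left; exists K; rewrite le_nK.
have q_gt0 : (0 < p ^ b.+1)%N by rewrite expn_gt0; lia.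
have lt_aK : (a.+1 < K)%N.
  rewrite -(ltn_exp2l _ _ (isT : 1 < 2)%N); apply: leq_ltn_trans lt_mK.
  by rewrite leq_pmulr.
have le_nm : (29 * (2 * n) <= 30 * m)%N.
  apply: leq_trans (_ : 29 * (2 ^ a.+1 * (p.+1 * p ^ b)) <= _)%N.
    by rewrite leq_mul2l.
  rewrite /m mulnCA [leqRHS]mulnCA leq_mul2l.
  by apply/orP; right; rewrite expnS !mulnA leq_mul2r; lia.
have [K_ge15|K_lt15] := leqP 15 K.
  have KE : (2 ^ K = 2 ^ 14 * 2 ^ (K - 14))%N by rewrite -expnD subnKC //; lia.
  (* [29/30 * 2^14 >= 5^6 >= 25/29 * 2^14] *)
  right; exists (K - 14)%N, 6%N; move: lt_Kn lt_mK; rewrite KE.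
  by set T := (2 ^ (K - 14))%N => lt_Kn lt_mK; split; lia.
exfalso; have KE : (2 ^ K = 2 ^ a.+1 * 2 ^ (K - a.+1))%N.
  by rewrite -expnD subnKC //; lia.
apply: (@no_pow2_small p b (K - a.+1)) => //; first by lia.
  by move: lt_mK; rewrite KE /m ltn_mul2l expn_gt0.
by have := leq_trans lt_Kn le_n; rewrite KE ltn_mul2l expn_gt0.
Qed.

Lemma pow2_trap k j x y : (2 ^ j <= x)%N -> (y <= 2 ^ j.+1)%N ->
  (x < 2 ^ k)%N -> (2 ^ k < y)%N -> False.
Proof.
move=> le_x le_y lt_x lt_y.
have := leq_ltn_trans le_x lt_x; have := leq_trans lt_y le_y.
by rewrite !ltn_exp2l //; lia.
Qed.

(** The ratio [14/13] is too large for [5^6] against [2^14], so [5^12] replaces [2^28]. This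
    requires large [K], and the small [b] are settled one by one. *)
Lemma sandwiched_13 n a b : (0 < n)%N ->
  (2 * n <= 2 ^ a.+1 * (14 * 13 ^ b))%N -> sandwiched n (2 ^ a.+1 * 13 ^ b.+1)%N.
Proof.
move=> n_gt0 le_n; set m := (_ * _)%N.
have [n_gt1|n_le1] := ltnP 1 n; last first.
  by left; exists 0%N; rewrite /m muln_gt0 !expn_gt0; lia.
have [K le_nK lt_Kn] := pow2_between n_gt1.
have [le_Km|lt_mK] := leqP (2 ^ K) m; first by left; exists K; rewrite le_nK.
have q_gt0 : (0 < 13 ^ b.+1)%N by rewrite expn_gt0.
have lt_aK : (a.+1 < K)%N.
  rewrite -(ltn_exp2l _ _ (isT : 1 < 2)%N); apply: leq_ltn_trans lt_mK.
  by rewrite leq_pmulr.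
have KE : (2 ^ K = 2 ^ a.+1 * 2 ^ (K - a.+1))%N.
  by rewrite -expnD subnKC //; lia.
have lt1 : (13 ^ b.+1 < 2 ^ (K - a.+1))%N.
  by move: lt_mK; rewrite KE /m ltn_mul2l expn_gt0.
have lt2 : (2 ^ (K - a.+1) < 14 * 13 ^ b)%N.
  by have := leq_trans lt_Kn le_n; rewrite KE ltn_mul2l expn_gt0.
have [b_ge7|b_lt7] := leqP 7 b.
  have K_ge29 : (29 <= K)%N.
    have : (13 ^ 8 <= 13 ^ b.+1)%N by rewrite leq_exp2l.
    move=> le8; have : (2 ^ 28 < 2 ^ (K - a.+1))%N by lia.
    by rewrite ltn_exp2l //; lia.
  have KE' : (2 ^ K = 2 ^ 28 * 2 ^ (K - 28))%N by rewrite -expnD subnKC //; lia.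
  have le_nm : (13 * (2 * n) <= 14 * m)%N.
    apply: leq_trans (_ : 13 * (2 ^ a.+1 * (14 * 13 ^ b)) <= _)%N.
      by rewrite leq_mul2l.
    rewrite /m mulnCA [leqRHS]mulnCA leq_mul2l; apply/orP; right.
    by rewrite expnS mulnCA.
  (* [13/14 * 2^28 >= 5^12 >= 35/39 * 2^28] *)
  right; exists (K - 28)%N, 12%N; move: lt_Kn lt_mK; rewrite KE'.
  by set T := (2 ^ (K - 28))%N => lt_Kn lt_mK; split; lia.
have [bE|b_neq6] := eqVneq b 6%N.
  (* [13^7 >= 2^5 * 5^9] *)
  right; exists (a.+1 + 5)%N, 9%N; rewrite expnD.
  move: le_n; rewrite /m bE; set T := (2 ^ a.+1)%N.
  by move=> le_n; split; lia.
(* For [b <= 5], no power of two separates [13^(b+1)] from [14] times [13^b]. *)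
exfalso; case: b {le_n lt_mK q_gt0 m} lt1 lt2 b_lt7 b_neq6 =>
  [|[|[|[|[|[|b]]]]]] lt1 lt2 lt7 neq6.
- by apply: (@pow2_trap _ 3 _ _ _ _ lt1 lt2); lia.
- by apply: (@pow2_trap _ 7 _ _ _ _ lt1 lt2); lia.
- by apply: (@pow2_trap _ 11 _ _ _ _ lt1 lt2); lia.
- by apply: (@pow2_trap _ 14 _ _ _ _ lt1 lt2); lia.
- by apply: (@pow2_trap _ 18 _ _ _ _ lt1 lt2); lia.
- by apply: (@pow2_trap _ 22 _ _ _ _ lt1 lt2); lia.
- by lia.
Qed.

Lemma discriminates_sandwiched n m : (0 < n)%N -> discriminates n m -> sandwiched n m.
Proof.
move=> n_gt0 dis; have m_gt0 : (0 < m)%N by case: dis.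
have [m' co mE] := pfactor_coprime (isT : prime 2) m_gt0.
have odd_m' : odd m' by rewrite -coprime2n.
case: (logn 2 m) mE => [|a] mE.
  move: dis; rewrite mE muln1 => dis.
  case: (odd_bound odd_m' dis) => [m1|m3|le_n]; last exact: sandwiched_double.
    have : (n <= 1)%N; last by left; exists 0%N; lia.
    by apply: (period_bound dis) => //; rewrite m1; split; exact: dvd1z.
  (* Modulo 3, [alpha^2 = -1], so at most two terms are distinguished and [2^1] fits. *)
  have : (n <= 2)%N; last by left; exists 1%N; lia.
  by apply: (reflection_bound dis (e := 2)) => //; rewrite m3.
move: dis; rewrite mE mulnC => dis.
case: (even_bound odd_m' dis) => [m1|le_n|[p [b [p_pr -> odd_p ne17 le_n]]]].
- left; exists a.+1; rewrite m1 muln1 leqnn andbT.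
  move: dis; rewrite m1 muln1 => dis.
  by apply: (period_bound dis (unit_pow_pow2 _)); rewrite expn_gt0.
- exact: sandwiched_double.
have [p_ge29|p_lt29] := leqP 29 p; first exact: sandwiched_large.
have /allP/(_ p) : all (fun p =>
    prime p && odd p./2.+1 ==> (p \in [:: 5; 13; 17]%N)) (iota 0 29) by [].
rewrite mem_iota leq0n add0n p_lt29 => /(_ isT); rewrite p_pr odd_p /=.
rewrite !inE (negPf ne17) orbF => /orP[] /eqP pE; rewrite pE in le_n *.
  (* For [p = 5] the bound on [n] reads [5 n <= 3 m], so [m] itself is a candidate for [w n]. *)
  right; exists a.+1, b.+1; split => //; rewrite [(5 ^ b.+1)%N]expnS.
  by move: le_n; lia.
exact: sandwiched_13.
Qed.

(** * Valuations at 2 and 5 *)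

Lemma odd_X n : (2 %| X n - 1)%Z.
Proof.
elim: n => [|n IHn]; first by rewrite /X U1 U0.
have -> : X n.+1 - 1 = (X n - 1) + 2 * (X n + 4 * U n) by rewrite X_succ; ring.
by rewrite rpredD // dvdz_mulr.
Qed.

Lemma U_parity n : (2 %| U n - n%:Z)%Z.
Proof.
elim: n => [|n IHn] //.
have -> : U n.+1 - n.+1%:Z = (U n - n%:Z) + (X n - 1) + 2 * U n.
  have -> : n.+1%:Z = n%:Z + 1 by rewrite -addn1 PoszD.
  by rewrite U_succ; ring.
apply: rpredD; last exact: dvdz_mulr.
by apply: rpredD => //; exact: odd_X.
Qed.

Lemma coprimez_prime_pow p a (x : int) : prime p -> ~~ (p %| x)%Z ->
  coprimez (p ^ a)%N x.
Proof.
by move=> p_pr ndvd; rewrite coprimezE coprimeXl // prime_coprime.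
Qed.

Lemma coprime_pow2_X a n : coprimez (2 ^ a)%N (X n).
Proof. by apply: coprimez_prime_pow => //; have := odd_X n; lia. Qed.

(** Each doubling of the index contributes exactly one factor 2, because [X] is odd. *)
Lemma pow2_dvd_U a k : ((2 ^ a)%N %| U k)%Z -> (2 ^ a %| k)%N.
Proof.
elim: a k => [|a IHa] k dvd_U; first by rewrite dvd1n.
have even_k : ~~ odd k.
  have : (2 %| U k)%Z by apply: dvdz_trans dvd_U; rewrite expnS PoszM dvdz_mulr.
  by have := U_parity k; lia.
have kE : k = (k./2).*2 by rewrite -[LHS]odd_double_half (negPf even_k).
rewrite kE -mul2n expnS dvdn_pmul2l // IHa //.
move: dvd_U; rewrite {1}kE U_double expnS PoszM dvdz_mul2l //=.
by rewrite Gauss_dvdzl // coprime_pow2_X.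
Qed.

Lemma pow2_dvd_sub a i j : (j <= i)%N ->
  ((2 ^ a)%N %| U i - U j)%Z -> (2 ^ a %| i - j)%N.
Proof.
case: a => [|a] le_ji dvd_U; first by rewrite dvd1n.
have even_ij : ~~ odd (i - j).
  have : (2 %| U i - U j)%Z.
    by apply: dvdz_trans dvd_U; rewrite expnS PoszM dvdz_mulr.
  by have := U_parity i; have := U_parity j; lia.
have ijE : (i - j = 2 * (i - j)./2)%N by lia.
rewrite ijE expnS dvdn_pmul2l //; apply: pow2_dvd_U.
have iE : i = (j + (i - j)./2.*2)%N by lia.
move: dvd_U; rewrite {1}iE U_sub_even expnS PoszM dvdz_mul2l //=.
by rewrite Gauss_dvdzl // coprime_pow2_X.
Qed.

Lemma discriminates_pow2 a n : (n <= 2 ^ a)%N -> discriminates n (2 ^ a)%N.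
Proof.
move=> le_n; split=> [|i j lt_in lt_jn ne_ij /eqmodzP dvd_U].
  by rewrite expn_gt0.
wlog le_ji : i j lt_in lt_jn ne_ij dvd_U / (j <= i)%N.
  move=> th; case/orP: (leq_total j i) => [|le_ij]; first exact: th.
  by apply: (th j i) => //; [exact: nesym|rewrite -opprB rpredN].
have := pow2_dvd_sub le_ji dvd_U; move/dvdn_leq; lia.
Qed.

(** Multiplication by [alpha^(q e)], which is [1] or [-1] modulo [m], only changes signs. *)
Lemma unit_pow_residue m (s : int) e q r : s = 1 \/ s = -1 -> unit_pow m s e ->
  ((m %| U (q * e + r))%Z -> (m %| U r)%Z) /\
  ((m %| X (q * e + r))%Z -> (m %| X r)%Z).
Proof.
move=> s_pm1 /(unit_powM q) [Uq Xq].
have t2 : s ^+ q * s ^+ q = 1.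
  by rewrite -expr2 -exprM mulnC exprM; case: s_pm1 => ->; rewrite ?sqrrN !expr1n.
move: (s ^+ q) t2 Xq => t t2 Xq; rewrite U_add X_add; split=> dvd_r.
  have -> : U r = t * (U (q * e) * X r + X (q * e) * U r)
     - t * X r * U (q * e) - t * U r * (X (q * e) - t) + U r * (1 - t * t) by ring.
  rewrite t2 subrr mulr0 addr0.
  by rewrite !rpredB //; exact: dvdz_mull.
have -> : X r = t * (X (q * e) * X r + 8 * U (q * e) * U r)
   - 8 * t * U r * U (q * e) - t * X r * (X (q * e) - t) + X r * (1 - t * t) by ring.
rewrite t2 subrr mulr0 addr0.
by rewrite !rpredB //; exact: dvdz_mull.
Qed.

Lemma unit_pow5 : unit_pow 5 (-1) 3.
Proof. by []. Qed.

Lemma dvd5_U k : (5 %| U k)%Z -> (3 %| k)%N.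
Proof.
rewrite {1}(divn_eq k 3) /dvdn.
move/(proj1 (unit_pow_residue _ _ (or_intror erefl) unit_pow5)).
have : (k %% 3 < 3)%N by rewrite ltn_mod.
by case: (k %% 3)%N => [|[|[]]].
Qed.

Lemma dvd5_X k : ~~ (5 %| X k)%Z.
Proof.
apply/negP; rewrite (divn_eq k 3).
move/(proj2 (unit_pow_residue _ _ (or_intror erefl) unit_pow5)).
have : (k %% 3 < 3)%N by rewrite ltn_mod.
by case: (k %% 3)%N => [|[|[]]].
Qed.

(** Write [k = 3 l]: to first order [U (3 l)] is [35 l] up to sign modulo 25, so 5 divides [l]. *)
Lemma dvd25_U k : (25 %| U k)%Z -> (15 %| k)%N.
Proof.
move=> dvd_U; have /dvdnP[l kE] : (3 %| k)%N.
  by apply: dvd5_U; apply: dvdz_trans dvd_U.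
have [kU _] := unit_pow_expand (N := 25) l (or_intror erefl)
  (isT : 25 %| 5 * 5)%N unit_pow5.
rewrite kE (@dvdn_pmul2r 3 5) //.
have : (25 %| l%:Z * ((-1) ^+ l * -1 * U 3))%Z.
  rewrite -[X in (_ %| X)%Z](subKr (U (l * 3))) rpredB //.
  by rewrite -kE.
have -> : U 3 = 35 by [].
by rewrite -signr_odd; case: (odd l) => /=; lia.
Qed.

(** Once 5 divides [U n], passing from [n] to [5 n] adds exactly one factor 5; the case of 25
    provides the index to divide by 5. *)
Lemma pow5_dvd_U b k : ((5 ^ b.+1)%N %| U k)%Z -> (3 * 5 ^ b %| k)%N.
Proof.
elim: b k => [|b IHb] k dvd_U; first by rewrite muln1; exact: dvd5_U.
have /dvdnP[l kE] : (15 %| k)%N.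
  apply: dvd25_U; apply: dvdz_trans dvd_U.
  by rewrite dvdzE; exact: (@dvdn_exp2l 5 2 b.+2).
have {}kE : k = (5 * (3 * l))%N by lia.
have /dvdzP[c Uc] : (5 %| U (3 * l))%Z.
  by have [+ _] := unit_powM l unit_pow5; rewrite mulnC.
move: dvd_U; rewrite kE U_quintuple.
set u := U (3 * l) in Uc *.
have -> : 1024 * u ^+ 4 + 160 * u ^+ 2 + 5 =
    5 * (1 + 5 * (1024 * 25 * c ^+ 4 + 160 * c ^+ 2)).
  by rewrite Uc; ring.
set f := 1 + _ => dvd_u.
have co : coprimez (5 ^ b.+1)%N f.
  by apply: coprimez_prime_pow => //; rewrite /f; lia.
have : ((5 ^ b.+1)%N %| u)%Z.
  rewrite -(Gauss_dvdzl _ co) -(@dvdz_mul2l 5) //.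
  by move: dvd_u; rewrite expnS PoszM mulrCA.
by move/IHb => dvd_l; rewrite expnS mulnCA dvdn_pmul2l.
Qed.

Lemma discriminates_pow25 a b n : (5 * n <= 3 * (2 ^ a.+1 * 5 ^ b.+1))%N ->
  discriminates n (2 ^ a.+1 * 5 ^ b.+1)%N.
Proof.
move=> le_n; split=> [|i j lt_in lt_jn ne_ij /eqmodzP dvd_U].
  by rewrite muln_gt0 !expn_gt0.
wlog le_ji : i j lt_in lt_jn ne_ij dvd_U / (j <= i)%N.
  move=> th; case/orP: (leq_total j i) => [|le_ij]; first exact: th.
  by apply: (th j i) => //; [exact: nesym|rewrite -opprB rpredN].
have co : coprime (2 ^ a.+1) (5 ^ b.+1) by rewrite coprime_pexpl // coprime_pexpr.
move: dvd_U; rewrite PoszM Gauss_dvdz // => /andP[dvd2 dvd5].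
have dvd_2 := pow2_dvd_sub le_ji dvd2.
have ijE : (i - j = 2 * (i - j)./2)%N.
  have : (2 %| i - j)%N by apply: dvdn_trans dvd_2; rewrite expnS dvdn_mulr.
  by lia.
have dvd_5 : (3 * 5 ^ b %| i - j)%N.
  rewrite ijE dvdn_mull //; apply: pow5_dvd_U.
  have iE : i = (j + (i - j)./2.*2)%N by lia.
  move: dvd5; rewrite {1}iE U_sub_even.
  have co5 (x : int) : ~~ (5 %| x)%Z -> coprimez (5 ^ b.+1)%N x.
    exact: coprimez_prime_pow.
  by rewrite Gauss_dvdzr ?co5 // Gauss_dvdzl ?co5 // dvd5_X.
(* This divisor is three fifths of the modulus, hence at least [n]. *)
have : (2 ^ a.+1 * (3 * 5 ^ b) %| i - j)%N.
  rewrite Gauss_dvd ?dvd_2 //.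
  by rewrite coprimeMr !coprime_pexpl //= coprimeXr.
move/dvdn_leq => le_ij.
have {}le_ij : (2 ^ a.+1 * (3 * 5 ^ b) <= i - j)%N by apply: le_ij; lia.
by move: le_n; rewrite [(5 ^ b.+1)%N]expnS; lia.
Qed.

(** * The formula for [D1] *)

Lemma v_spec n : exists2 a, v n = (2 ^ a)%N & (n <= v n)%N.
Proof. by have [[[a vE] le_n] _] := leastP (pow2_ge_ex n); exists a. Qed.

Lemma v_le n k : (n <= 2 ^ k)%N -> (v n <= 2 ^ k)%N.
Proof.
by move=> le_n; apply: (proj2 (leastP (pow2_ge_ex n))); split=> //; exists k.
Qed.

Lemma five_thirds_le (n m : nat) :
  (5 * n%:R / 3 <= m%:R :> rat) = (5 * n <= 3 * m)%N.
Proof. by rewrite ler_pdivrMr ?ltr0n // -!natrM ler_nat [(m * 3)%N]mulnC. Qed.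

Lemma w_spec n : exists a b, w n = (2 ^ a.+1 * 5 ^ b.+1)%N /\ (5 * n <= 3 * w n)%N.
Proof.
have [[[[|a] [[|b] [//= _ _ wE]]] +] _] := leastP (pow25_ge_ex n).
by rewrite five_thirds_le; exists a, b.
Qed.

Lemma w_le n a b : (0 < a)%N -> (0 < b)%N ->
  (5 * n <= 3 * (2 ^ a * 5 ^ b))%N -> (w n <= 2 ^ a * 5 ^ b)%N.
Proof.
move=> a_gt0 b_gt0 le_n; apply: (proj2 (leastP (pow25_ge_ex n))).
by split; [exists a, b|rewrite five_thirds_le].
Qed.

(** Both [v n] and [w n] discriminate; conversely [D1 n] is sandwiched, so it is at least one of
    them. *)
Lemma D1E n : (0 < n)%N -> D1 n = minn (v n) (w n).
Proof.
move=> n_gt0; have [dis min_D1] := leastP (discriminates_ex n).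
apply/eqP; rewrite eqn_leq leq_min geq_min -/(D1 n); apply/andP; split.
  apply/andP; split; apply: min_D1.
    by have [a -> le_n] := v_spec n; exact: discriminates_pow2.
  by have [a [b [wE]]] := w_spec n; rewrite wE; exact: discriminates_pow25.
have [[k /andP[le_n le_D]]|[a [b [a_gt0 b_gt0 le_n le_D]]]] :=
  discriminates_sandwiched n_gt0 dis.
  by rewrite (leq_trans (v_le le_n) le_D).
by rewrite (leq_trans (w_le a_gt0 b_gt0 le_n) le_D) orbT.
Qed.

(** * The set of values *)

Lemma frac_log2_5 (R : realType) b k : (2 ^ k <= 5 ^ b)%N -> (5 ^ b < 2 ^ k.+1)%N ->
  Defs.frac (b%:R * (ln 5 / ln 2) : R) = (b%:R * ln 5 - k%:R * ln 2) / ln 2.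
Proof.
move=> le_k lt_k; have ln2_gt0 : 0 < ln 2 :> R by rewrite ln_gt0 // ltr1n.
rewrite /Defs.frac (@floor_def _ _ k).
  by field; rewrite gt_eqF.
rewrite mulrA ler_pdivlMr // ltr_pdivrMr //.
rewrite intrD natr1 -pmulrn.
rewrite !mulr_natl -!lnXn ?ltr0n // ler_ln ?ltr_ln ?posrE ?exprn_gt0 ?ltr0n //.
by rewrite -!natrX ler_nat ltr_nat le_k lt_k.
Qed.

(** Exponentiating in base 2, the condition becomes [5^(b+1) / 2^k >= 5/3]. *)
Lemma in_M (R : realType) b k : (2 ^ k <= 5 ^ b.+1)%N -> (5 ^ b.+1 < 2 ^ k.+1)%N ->
  M R b.+1 <-> (2 ^ k <= 3 * 5 ^ b)%N.
Proof.
move=> le_k lt_k; have ln2_gt0 : 0 < ln 2 :> R by rewrite ln_gt0 // ltr1n.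
rewrite /M /= (frac_log2_5 R le_k lt_k).
suff -> : (1 - ln (6 / 5) / ln 2 <= (b.+1%:R * ln 5 - k%:R * ln 2) / ln 2 :> R) =
          (2 ^ k <= 3 * 5 ^ b)%N by split=> [[]|].
rewrite ler_pdivlMr // mulrBl mul1r divfK ?gt_eqF //.
rewrite -ln_div ?posrE ?divr_gt0 ?ltr0n //.
rewrite lerBrDr ![_%:R * ln _]mulr_natl -!lnXn ?ltr0n //.
rewrite -lnM ?posrE ?exprn_gt0 ?divr_gt0 ?ltr0n //.
rewrite ler_ln ?posrE ?mulr_gt0 ?exprn_gt0 ?divr_gt0 ?ltr0n //.
have -> : 2 / (6 / 5) * 2 ^+ k = 5 * 2 ^+ k / 3 :> R by field.
rewrite ler_pdivrMr ?ltr0n // -!natrX -!natrM ler_nat expnS -mulnA leq_mul2l /=.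
by rewrite mulnC.
Qed.

Lemma M_pow2P (R : realType) b : M R b.+1 <->
  exists2 k, (2 ^ k <= 3 * 5 ^ b)%N & (5 ^ b.+1 < 2 ^ k.+1)%N.
Proof.
split=> [Mb|[k le_k lt_k]].
  have pow_gt0 : (0 < 5 ^ b.+1)%N by rewrite expn_gt0.
  have /andP[le_k lt_k] := trunc_log_bounds (isT : 1 < 2)%N pow_gt0.
  by exists (trunc_log 2 (5 ^ b.+1)) => //; apply/(in_M R le_k lt_k).
by apply/(in_M R _ lt_k) => //; rewrite expnS; lia.
Qed.

Lemma v_gt_half n k : (1 < n)%N -> v n = (2 ^ k)%N -> (2 ^ k < 2 * n)%N.
Proof.
move=> n_gt1 <-; have [j le_n lt_j] := pow2_between n_gt1.
exact: leq_ltn_trans (v_le le_n) lt_j.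
Qed.

Lemma D1_pow2 a : D1 (2 ^ a) = (2 ^ a)%N.
Proof.
have pow_gt0 : (0 < 2 ^ a)%N by rewrite expn_gt0.
rewrite D1E //; have le_v := v_le (leqnn (2 ^ a)); have [_ _ ge_v] := v_spec (2 ^ a).
have [_ [_ [_ le_w]]] := w_spec (2 ^ a).
have -> : v (2 ^ a) = (2 ^ a)%N by apply/eqP; rewrite eqn_leq le_v.
by apply/minn_idPl; lia.
Qed.

(** This [n] satisfies [5 n / 3 = 2^(a+1) 5^(b+1)], which fixes [w n]; the hypotheses on [k] keep
    powers of two out of the gap between [n] and [w n]. *)
Lemma D1_pow25 a b k : (2 ^ k <= 3 * 5 ^ b)%N -> (5 ^ b.+1 < 2 ^ k.+1)%N ->
  D1 (3 * (2 ^ a.+1 * 5 ^ b)) = (2 ^ a.+1 * 5 ^ b.+1)%N.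
Proof.
move=> le_k lt_k; set n := (3 * _)%N.
have n_gt0 : (0 < n)%N by rewrite /n !muln_gt0 !expn_gt0.
have wE : w n = (2 ^ a.+1 * 5 ^ b.+1)%N.
  apply/eqP; rewrite eqn_leq w_le //=; last by rewrite /n [(5 ^ b.+1)%N]expnS; lia.
  have [_ [_ [_ le_w]]] := w_spec n.
  by rewrite [(5 ^ b.+1)%N]expnS; move: le_w; rewrite /n; lia.
rewrite D1E // wE; apply/minn_idPr.
have [c vE le_v] := v_spec n; rewrite vE in le_v *.
(* [n] is divisible by [3], so it is not a power of two. *)
have lt_v : (2 ^ (a.+1 + k) < 2 ^ c)%N.
  apply: leq_ltn_trans (_ : n < _)%N.
    by rewrite expnD /n mulnCA leq_mul2l le_k orbT.
  rewrite ltn_neqAle le_v andbT; apply: contraTneq (isT : ~~ (3 %| 1)%N) => nE.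
  have : (3 %| 2 ^ c)%N by rewrite -nE dvdn_mulr.
  by rewrite Euclid_dvdX.
move: lt_v; rewrite ltn_exp2l // => lt_c.
apply: leq_trans (_ : 2 ^ (a.+1 + k.+1) <= _)%N; last by rewrite leq_exp2l // addnS.
by rewrite expnD leq_mul2l ltnW ?orbT.
Qed.

Theorem theorem1 (R : realType) :
  (forall n : nat, (1 <= n)%N -> D1 n = minn (v n) (w n)) /\
  [set D1 n | n in [set n : nat | (2 <= n)%N]] =
  [set (2 ^ a * 5 ^ b)%N | a in [set a : nat | (1 <= a)%N]
                         & b in M R `|` [set 0%N]].
Proof.
split; first exact: D1E.
apply/seteqP; split=> [_ [n /= n_gt1 <-]|_ [[|a] //= _ [b bM <-]]].
  have n_gt0 := ltnW n_gt1; rewrite (D1E n_gt0).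
  have [c vE le_n] := v_spec n; have lt_v := v_gt_half n_gt1 vE.
  have [le_vw|lt_wv] := leqP (v n) (w n).
    exists c; last by exists 0%N; [right|rewrite muln1].
    by rewrite /= lt0n; apply: contraTneq n_gt1 => c0; rewrite vE c0 in le_n; lia.
  have [a [b [wE le_w]]] := w_spec n; rewrite wE vE in lt_wv le_w *.
  exists a.+1 => //; exists b.+1 => //; left; apply/M_pow2P.
  have lt_ac : (a.+1 < c)%N.
    rewrite -(ltn_exp2l _ _ (isT : 1 < 2)%N); apply: leq_ltn_trans lt_wv.
    by rewrite leq_pmulr // expn_gt0.
  have pow_gt0 : (0 < 2 ^ a.+1)%N by rewrite expn_gt0.
  (* Dividing [w n < 2^c < 2 n <= 6/5 w n] by [2 ^ a.+1] yields the two inequalities for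
     [k = c - a - 2]. *)
  have cE : (2 ^ c = 2 ^ a.+1 * 2 ^ (c - a.+2).+1)%N.
    by rewrite -expnD; congr (_ ^ _)%N; lia.
  rewrite cE in lt_v lt_wv; exists (c - a.+2)%N; last by rewrite ltn_pmul2l in lt_wv.
  rewrite -(leq_pmul2l pow_gt0); move: lt_v le_w.
  by rewrite [(2 ^ (c - a.+2).+1)%N]expnS [(5 ^ b.+1)%N]expnS; lia.
case: b bM => [_|b].
  by exists (2 ^ a.+1)%N; rewrite ?muln1 ?D1_pow2 //= expnS leq_pmulr ?expn_gt0.
case=> [/M_pow2P[k le_k lt_k]|//].
exists (3 * (2 ^ a.+1 * 5 ^ b))%N; last exact: D1_pow25 le_k lt_k.
by rewrite /= -[2%N]/(2 * 1)%N leq_mul // muln_gt0 !expn_gt0.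
Qed.
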